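(* Let $f$ be a continuous function on $B_1$ with $0<\nu\le f(x)\le M<\infty$ for all $x\in B_1$, let $u\in C(\overline{B_1})$ be a viscosity solution of $$\min\{f(x)-\Delta_\infty u,\ u\}=0\ \text{ in }B_1,$$ and let $x_0\in\partial\{u>0\}\cap B_1$ be a free boundary point. Then there is a constant $C>0$, depending only on the data of the problem (namely on $n$, $\nu$, $M$, $\sup_{B_1}u$ and $\mathrm{dist}(x_0,\partial B_1)$), such that $$\sup_{y\in B_r(x_0)}u(y)\le C\,r^{4/3}$$ for every $r>0$ with $B_r(x_0)\subset B_1$.
   Context: $B_r(x)$ is the open ball of radius $r$ and center $x$ in $\mathbb{R}^n$, $B_1=B_1(0)$, and $\Delta_\infty u=\sum_{i,j}u_{x_i}u_{x_j}u_{x_ix_j}$. A continuous function $u$ satisfies $\min\{f-\Delta_\infty u,u\}=0$ in $B_1$ in the viscosity sense if $u\ge0$ in $B_1$, $\Delta_\infty u\le f$ in $B_1$, and $\Delta_\infty u\ge f$ in $\{u>0\}$, the last two inequalities in the viscosity sense. Here $\Delta_\infty u\le f$ (resp. $\ge f$) in an open set in the viscosity sense means: whenever $\varphi\in C^2$ touches $u$ from below (resp. from above) at a point $x$ of that set, $\Delta_\infty\varphi(x)\le f(x)$ (resp. $\ge f(x)$). *)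

(* Defs.v *)
From HB Require Import structures.
From mathcomp Require Import all_boot all_order all_algebra.
From mathcomp Require Import all_classical all_reals all_analysis.

Set Implicit Arguments.
Unset Strict Implicit.
Unset Printing Implicit Defensive.

Import Order.TTheory GRing.Theory Num.Theory.
Import numFieldNormedType.Exports.

Local Open Scope classical_set_scope.
Local Open Scope ring_scope.

(* The library norm on 'rV[R]_n is the sup norm. The Euclidean norm is needed
   for balls and distances; both norms induce the same topology, so the library
   closure, interior, continuity and filters on 'rV[R]_n are used as they are. *)
Definition eucl_norm (R : realType) (n : nat) (x : 'rV[R]_n) : R :=
  Num.sqrt (\sum_(i < n) x 0 i ^+ 2).

Definition eucl_ball (R : realType) (n : nat) (x : 'rV[R]_n) (r : R) :
    set 'rV[R]_n :=
  [set y | eucl_norm (y - x) < r].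

Definition boundary (T : topologicalType) (A : set T) : set T :=
  closure A `\` interior A.

Definition eucl_dist (R : realType) (n : nat) (x : 'rV[R]_n)
    (A : set 'rV[R]_n) : \bar R :=
  ereal_inf [set (eucl_norm (x - y))%:E | y in A].

Definition esup_on (R : realType) (T : Type) (A : set T) (u : T -> R) : \bar R :=
  ereal_sup [set (u y)%:E | y in A].

Definition partial (R : realType) (n : nat) (i : 'I_n) (phi : 'rV[R]_n -> R) :
    'rV[R]_n -> R :=
  fun x => 'D_(delta_mx 0 i) phi x.

Definition C2_near (R : realType) (n : nat) (phi : 'rV[R]_n -> R)
    (x : 'rV[R]_n) : Prop :=
  \forall y \near x,
    {for y, continuous phi} /\
    forall i : 'I_n,
      [/\ derivable phi y (delta_mx 0 i),
          {for y, continuous (partial i phi)} &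
          forall j : 'I_n,
            derivable (partial i phi) y (delta_mx 0 j) /\
            {for y, continuous (partial j (partial i phi))}].

Definition infty_laplacian (R : realType) (n : nat) (phi : 'rV[R]_n -> R)
    (x : 'rV[R]_n) : R :=
  \sum_(i < n) \sum_(j < n)
    partial i phi x * partial j phi x * partial j (partial i phi) x.

Definition touches_below (R : realType) (n : nat) (phi u : 'rV[R]_n -> R)
    (x : 'rV[R]_n) : Prop :=
  phi x = u x /\ \forall y \near x, phi y <= u y.

Definition touches_above (R : realType) (n : nat) (phi u : 'rV[R]_n -> R)
    (x : 'rV[R]_n) : Prop :=
  phi x = u x /\ \forall y \near x, u y <= phi y.

(* Delta_oo u <= f in the viscosity sense; meant for open A *)
Definition visc_le (R : realType) (n : nat) (A : set 'rV[R]_n)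
    (u f : 'rV[R]_n -> R) : Prop :=
  forall (x : 'rV[R]_n) (phi : 'rV[R]_n -> R),
    A x -> C2_near phi x -> touches_below phi u x ->
    infty_laplacian phi x <= f x.

(* Delta_oo u >= f in the viscosity sense; meant for open A *)
Definition visc_ge (R : realType) (n : nat) (A : set 'rV[R]_n)
    (u f : 'rV[R]_n -> R) : Prop :=
  forall (x : 'rV[R]_n) (phi : 'rV[R]_n -> R),
    A x -> C2_near phi x -> touches_above phi u x ->
    f x <= infty_laplacian phi x.

Definition positivity_set (R : realType) (n : nat) (D : set 'rV[R]_n)
    (u : 'rV[R]_n -> R) : set 'rV[R]_n :=
  D `&` [set x | 0 < u x].

(* min {f - Delta_oo u, u} = 0 in the viscosity sense; meant for open D and
   u continuous on D, so that the positivity set is open *)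
Definition visc_obstacle (R : realType) (n : nat) (D : set 'rV[R]_n)
    (f u : 'rV[R]_n -> R) : Prop :=
  [/\ forall x, D x -> 0 <= u x,
      visc_le D u f &
      visc_ge (positivity_set D u) u f].

(* Main.v *)
Require Import Defs.
From HB Require Import structures.
From mathcomp Require Import all_boot all_order all_algebra.
From mathcomp Require Import all_classical all_reals all_analysis.
From mathcomp Require Import ring lra.

Set Implicit Arguments.
Unset Strict Implicit.
Unset Printing Implicit Defensive.

Import Order.TTheory GRing.Theory Num.Theory.
Import numFieldNormedType.Exports.

Local Open Scope classical_set_scope.
Local Open Scope ring_scope.

(* Let q = |x - y|. The cone-like barrier w(x) = A ((2 r - q)^2 - r^2) vanishes on
   the sphere q = r, equals 3 A r^2 at its pole y, and away from the pole
   satisfies Delta_oo w = 8 A^3 (2 r - q)^2 >= 8 A^3 r^2, which exceeds M once A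
   is of order r^(-2/3). If u(y) >= 3 A r^2, comparison of u with w on the ball
   gives u >= w > 0 inside it, so that the ball contains no zero of u. Hence near
   a free boundary point u is at most of order r^(4/3); for r > d / 2 the bound
   u <= s suffices. *)

(** * The Euclidean norm: norm axioms, continuity, compact balls *)

Section EuclideanNorm.
Context {R : realType} {n : nat}.
Implicit Types x y v : 'rV[R]_n.

Lemma eucl_norm_ge0 x : 0 <= eucl_norm x.
Proof. exact: sqrtr_ge0. Qed.

Lemma eucl_norm_sqr x : eucl_norm x ^+ 2 = \sum_(i < n) x 0 i ^+ 2.
Proof. by rewrite sqr_sqrtr// sumr_ge0// => i _; exact: sqr_ge0. Qed.

Lemma eucl_norm0 : eucl_norm (0 : 'rV[R]_n) = 0.
Proof. by rewrite /eucl_norm big1 ?sqrtr0// => i _; rewrite mxE expr0n. Qed.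

Lemma eucl_normZ (t : R) x : eucl_norm (t *: x) = `|t| * eucl_norm x.
Proof.
rewrite /eucl_norm -sqrtr_sqr -sqrtrM ?sqr_ge0// mulr_sumr.
by under eq_bigr do rewrite mxE exprMn.
Qed.

Lemma eucl_normN x : eucl_norm (- x) = eucl_norm x.
Proof. by rewrite -scaleN1r eucl_normZ normrN1 mul1r. Qed.

Lemma eucl_norm_delta (i : 'I_n) : eucl_norm (delta_mx 0 i : 'rV[R]_n) = 1.
Proof.
rewrite /eucl_norm (bigD1 i)//= big1 => [|j /negPf ji].
  by rewrite mxE !eqxx expr1n addr0 sqrtr1.
by rewrite mxE ji expr0n.
Qed.

Lemma le_coord_eucl_norm x i : `|x 0 i| <= eucl_norm x.
Proof.
rewrite -sqrtr_sqr ler_wsqrtr// (bigD1 i)//= lerDl.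
by rewrite sumr_ge0// => j _; exact: sqr_ge0.
Qed.

Lemma eucl_norm_eq0 x : (eucl_norm x == 0) = (x == 0).
Proof.
apply/eqP/eqP => [x0|->]; last exact: eucl_norm0.
apply/rowP => i; rewrite mxE; apply/eqP; rewrite -normr_le0 -x0.
exact: le_coord_eucl_norm.
Qed.

(** Cauchy-Schwarz: for nonzero vectors with norms [a] and [b], the sum of the squares of the
    entries of [b x - a y] is [2ab (ab - x.y)], so the last factor is nonnegative. *)
Lemma dot_le_eucl_norm x y :
  \sum_(i < n) x 0 i * y 0 i <= eucl_norm x * eucl_norm y.
Proof.
have [->|x0] := eqVneq x 0.
  by rewrite eucl_norm0 mul0r big1// => i _; rewrite mxE mul0r.
have [->|y0] := eqVneq y 0.
  by rewrite eucl_norm0 mulr0 big1// => i _; rewrite mxE mulr0.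
set a := eucl_norm x; set b := eucl_norm y.
have a_gt0 : 0 < a by rewrite lt_def eucl_norm_eq0 x0 eucl_norm_ge0.
have b_gt0 : 0 < b by rewrite lt_def eucl_norm_eq0 y0 eucl_norm_ge0.
have : 0 <= \sum_(i < n) (b * x 0 i - a * y 0 i) ^+ 2.
  by apply: sumr_ge0 => i _; exact: sqr_ge0.
have -> : \sum_(i < n) (b * x 0 i - a * y 0 i) ^+ 2 =
    2 * (a * b) * (a * b - \sum_(i < n) x 0 i * y 0 i).
  transitivity (b ^+ 2 * a ^+ 2 + a ^+ 2 * b ^+ 2
      - (2 * (a * b)) * \sum_(i < n) x 0 i * y 0 i); last by ring.
  rewrite !eucl_norm_sqr !mulr_sumr -sumrN -!big_split/=.
  by apply: eq_bigr => i _; rewrite -!eucl_norm_sqr -/a -/b; ring.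
by rewrite pmulr_rge0 ?subr_ge0// mulr_gt0// mulr_gt0.
Qed.

Lemma ler_eucl_normD x y : eucl_norm (x + y) <= eucl_norm x + eucl_norm y.
Proof.
rewrite -(@ler_pXn2r _ 2)// ?nnegrE ?addr_ge0 ?eucl_norm_ge0//.
have -> : eucl_norm (x + y) ^+ 2 = eucl_norm x ^+ 2 + eucl_norm y ^+ 2
    + 2 * \sum_(i < n) x 0 i * y 0 i.
  rewrite !eucl_norm_sqr mulr_sumr -!big_split/=.
  by apply: eq_bigr => i _; rewrite mxE; ring.
have := dot_le_eucl_norm x y; nra.
Qed.

Lemma eucl_norm_continuous : continuous (@eucl_norm R n).
Proof.
move=> x; apply: (@continuous_comp _ _ _ (fun x => \sum_(i < n) x 0 i ^+ 2)).
  apply: (@continuous_big _ _ _ _ _ _ _ _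
    (fun (i : 'I_n) (x : 'rV[R]_n) => x 0 i ^+ 2)); first exact: add_continuous.
  move=> i _ z.
  apply: (@continuous_comp _ _ _ (fun x : 'rV[R]_n => x 0 i) (fun t => t ^+ 2)).
    exact: coord_continuous.
  exact: exprn_continuous.
exact: sqrt_continuous.
Qed.

Lemma eucl_normB_continuous y : continuous (fun x => eucl_norm (x - y)).
Proof.
move=> x; apply: (@continuous_comp _ _ _ (fun x => x - y)).
  apply: (@continuousB _ _ _ id (cst y)) => ?; first exact: cvg_id.
  exact: cst_continuous.
exact: eucl_norm_continuous.
Qed.

Lemma open_eucl_ball x (r : R) : open (eucl_ball x r).
Proof.
rewrite (_ : eucl_ball x r =
  (fun y => eucl_norm (y - x)) @^-1` [set t | t < r])//.
by apply: open_comp; [move=> ? _; exact: eucl_normB_continuous|exact: open_lt].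
Qed.

Lemma compact_eucl_closed_ball y (r : R) :
  compact [set x | eucl_norm (x - y) <= r].
Proof.
apply: bounded_closed_compact; last first.
  rewrite (_ : mkset _ = (fun x => eucl_norm (x - y)) @^-1` [set t | t <= r])//.
  apply: closed_comp; last exact: closed_le.
  by move=> ? _; exact: eucl_normB_continuous.
exists (r + eucl_norm y); split=> [|M /ltW rM x /= xyr]; first exact: num_real.
have xM : eucl_norm x <= M.
  rewrite -(subrK y x) (le_trans (ler_eucl_normD _ _))//.
  by rewrite (le_trans _ rM)// lerD2r.
(* Boundedness refers to the sup norm, which the Euclidean norm dominates coordinate by
   coordinate. *)
suff: mx_norm x <= M by [].
rewrite mx_normrE; apply: bigmax_le => [|[i j] _ /=].
  exact: le_trans (eucl_norm_ge0 _) xM.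
by rewrite (ord1 i) (le_trans (le_coord_eucl_norm _ _)).
Qed.

End EuclideanNorm.

(** * Directional derivatives and a criterion for C2 *)

Lemma derive_line {R : realType} {V : normedModType R} (f : V -> R) (x v : V) :
  'D_1 (fun h : R => f (h *: v + x)) 0 = 'D_v f x.
Proof.
rewrite /derive; set F := fun h => _; set G := fun h => _.
suff -> : F = G by [].
by apply/funext => h; rewrite /F /G/= addr0 scale0r add0r [_%:A]mulr1.
Qed.

(** A chain rule that asks of [f] only a derivative along [v]: restricting to the line [h *: v + x]
    reduces it to the one-variable rule. *)
Lemma is_derive_comp1 {R : realType} {V : normedModType R} (g : R -> R)
    (f : V -> R) (x v : V) (df dg : R) :
  is_derive x v f df -> is_derive (f x) 1 g dg ->
  is_derive x v (g \o f) (df * dg).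
Proof.
move=> [fx fdf] gdg.
pose l h := f (h *: v + x).
have lE : is_derive (0 : R) 1 l df.
  apply: DeriveDef; first exact: (derivable1P f x v).1 fx.
  by rewrite derive_line.
have l0 : l 0 = f x by rewrite /l scale0r add0r.
rewrite -l0 in gdg.
have [gl glE] := is_derive1_comp gdg lE.
apply: DeriveDef; first exact: (derivable1P (g \o f) x v).2 gl.
by rewrite mulrC -glE -derive_line.
Qed.

Lemma is_derive_coord {R : realType} {n : nat} (x v : 'rV[R]_n) i :
  is_derive x v (fun x => x 0 i) (v 0 i).
Proof.
apply: DeriveDef; first exact/diff_derivable/differentiable_coord.
rewrite /derive; apply: cvg_lim; first exact: norm_hausdorff.
apply: cvg_near_cst; near=> h; rewrite /= !mxE addrK [_ *: _]mulrA mulVf ?mul1r//.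
by near: h; exact: nbhs_dnbhs_neq.
Unshelve. all: by end_near. Qed.

(** Chain rule for the square root of the sum of squares; [x != 0] keeps the root away from its
    singularity. *)
Lemma is_derive_eucl_norm {R : realType} {n : nat} (x v : 'rV[R]_n) :
  x != 0 -> is_derive x v (@eucl_norm R n)
    ((\sum_(i < n) x 0 i * v 0 i) / eucl_norm x).
Proof.
move=> x0; have nx0 : eucl_norm x != 0 by rewrite eucl_norm_eq0.
have S : is_derive x v (\sum_(i < n) (fun x : 'rV[R]_n => x 0 i) ^+ 2)
    (\sum_(i < n) ((2 * x 0 i ^+ 1) *: v 0 i)).
  by apply: is_derive_sum => i; apply: is_deriveX; exact: is_derive_coord.
have SE : (\sum_(i < n) (fun x : 'rV[R]_n => x 0 i) ^+ 2)
    = (fun x : 'rV[R]_n => \sum_(i < n) x 0 i ^+ 2).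
  by apply/funext => z; rewrite fct_sumE.
rewrite SE in S.
have Q : is_derive (\sum_(i < n) x 0 i ^+ 2) 1 Num.sqrt (2 * eucl_norm x)^-1.
  apply: is_derive1_sqrt; rewrite -eucl_norm_sqr.
  by rewrite exprn_gt0// lt_def nx0 eucl_norm_ge0.
apply: is_derive_eq (is_derive_comp1 S Q) _.
rewrite (eq_bigr (fun i => 2 * (x 0 i * v 0 i))) => [|i _].
  by rewrite -mulr_sumr; field.
by rewrite expr1 /GRing.scale/= mulrA.
Qed.

Lemma is_derive_eucl_normB {R : realType} {n : nat} (y x v : 'rV[R]_n) :
  x != y -> is_derive x v (fun x => eucl_norm (x - y))
    ((\sum_(i < n) (x - y) 0 i * v 0 i) / eucl_norm (x - y)).
Proof.
rewrite -subr_eq0 => /(@is_derive_eucl_norm _ _ _ v)[dx dE].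
have E : (fun h : R => h^-1 *: (((fun x => eucl_norm (x - y)) \o shift x) (h *: v)
      - (fun x => eucl_norm (x - y)) x)) =
    (fun h : R => h^-1 *: ((@eucl_norm R n \o shift (x - y)) (h *: v)
      - eucl_norm (x - y))).
  by apply/funext => h /=; rewrite addrA.
by apply: DeriveDef; rewrite /derivable /derive E.
Qed.

(** Lets explicit formulas [P] and [H] stand for the gradient and the Hessian, so that regularity
    and the infinity Laplacian are read off from them. *)
Lemma C2_near_intro {R : realType} {n : nat} (phi : 'rV[R]_n -> R)
    (P : 'I_n -> 'rV[R]_n -> R) (H : 'I_n -> 'I_n -> 'rV[R]_n -> R)
    (x : 'rV[R]_n) :
  (\forall y \near x,
    {for y, continuous phi} /\
    forall i, [/\ is_derive y (delta_mx 0 i) phi (P i y),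
      {for y, continuous (P i)} &
      forall j, is_derive y (delta_mx 0 j) (P i) (H i j y) /\
        {for y, continuous (H i j)}]) ->
  C2_near phi x /\ infty_laplacian phi x =
    \sum_(i < n) \sum_(j < n) P i x * P j x * H i j x.
Proof.
move=> C; pose G y := {for y, continuous phi} /\
    forall i, [/\ is_derive y (delta_mx 0 i) phi (P i y),
      {for y, continuous (P i)} &
      forall j, is_derive y (delta_mx 0 j) (P i) (H i j y) /\
        {for y, continuous (H i j)}].
have PE i : \forall y \near x, P i y = partial i phi y.
  near=> y; apply/esym/derive_val.
  have [_ /(_ i)[? _ _]] : G y by near: y; exact: C.
  by [].
have HE i j : \forall y \near x, H i j y = partial j (partial i phi) y.
  (* Differentiating once more at [y] requires the first-order identity on a whole neighbourhood of
     [y]; [near_join] supplies it. *)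
  near=> y; have Py : \forall z \near y, P i z = partial i phi z.
    by near: y; exact: near_join (PE i).
  rewrite /partial -(near_eq_derive _ Py); apply/esym/derive_val.
  have [_ /(_ i)[_ _ /(_ j)[? _]]] : G y by near: y; exact: C.
  by [].
have eq_cont (f g : 'rV[R]_n -> R) y : (\forall z \near y, f z = g z) ->
    {for y, continuous f} -> {for y, continuous g}.
  move=> fg cf; rewrite /prop_for /continuous_at -(nbhs_singleton fg).
  exact: cvg_trans (near_eq_cvg fg) cf.
split.
  (* Finitely many indices, so one neighbourhood of [x] serves all of them. *)
  have PEn : \forall y \near x, forall i,
      \forall z \near y, P i z = partial i phi z.
    exact: (@filter_forall _ _ (fun i y => \near y, P i y = partial i phi y)
      (nbhs x) _ (fun i => near_join (PE i))).
  have HEn : \forall y \near x, forall ij,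
      \forall z \near y, H ij.1 ij.2 z = partial ij.2 (partial ij.1 phi) z.
    exact: (@filter_forall _ _ (fun ij y =>
      \near y, H ij.1 ij.2 y = partial ij.2 (partial ij.1 phi) y)
      (nbhs x) _ (fun ij => near_join (HE ij.1 ij.2))).
  near=> y.
  have [cy Cy] : G y by near: y; exact: C.
  have Py : forall i, \forall z \near y, P i z = partial i phi z by near: y.
  have Hy : forall ij, \forall z \near y,
      H ij.1 ij.2 z = partial ij.2 (partial ij.1 phi) z by near: y.
  split=> // i; have [[di _] cP Cj] := Cy i; split=> //; first exact: eq_cont cP.
  move=> j; have [[dj _] cH] := Cj j; split; last exact: eq_cont (Hy (i, j)) cH.
  exact: near_eq_derivable dj.
rewrite /infty_laplacian; apply: eq_bigr => i _; apply: eq_bigr => j _.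
by rewrite -(nbhs_singleton (PE i)) -(nbhs_singleton (PE j))
  -(nbhs_singleton (HE i j)).
Unshelve. all: by end_near. Qed.

(** * The cone barrier and comparison with it *)

(** For a radial function [g(q)] the infinity Laplacian is [g'(q)^2 g''(q)]; here [g' = -2A(2r - q)]
    and [g'' = 2A]. The constant [m] leaves room for a vertical shift. *)
Lemma cone_infty_laplacian {R : realType} {n : nat} (A r m : R)
    (y p : 'rV[R]_n) :
  p != y ->
  C2_near (fun x => A * ((2 * r - eucl_norm (x - y)) ^+ 2 - r ^+ 2) + m) p /\
  infty_laplacian
    (fun x => A * ((2 * r - eucl_norm (x - y)) ^+ 2 - r ^+ 2) + m) p =
  8 * A ^+ 3 * (2 * r - eucl_norm (p - y)) ^+ 2.
Proof.
move=> py; set w := fun x : 'rV[R]_n => _.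
pose q := fun x : 'rV[R]_n => eucl_norm (x - y).
have qC : continuous q by exact: eucl_normB_continuous.
pose z (i : 'I_n) := (fun x : 'rV[R]_n => x 0 i) - cst (y 0 i).
have zE i x : z i x = (x - y) 0 i by rewrite !mxE.
pose g := A *: ((cst (2 * r) - id) ^+ 2 - cst (r ^+ 2)) + cst m : R -> R.
pose k := cst (2 * A) - (4 * A * r) *: (fun t : R => t^-1) : R -> R.
(* [h] is the derivative of [k] away from 0. *)
pose h := (4 * A * r) *: ((fun t : R => t^-1) ^+ 2) : R -> R.
have gD (t : R) : is_derive t 1 g (- (2 * A * (2 * r - t))).
  apply: is_derive_eq; rewrite /GRing.scale/= !fctE/=; ring.
have kD (t : R) : t != 0 -> is_derive t 1 k (h t).
  move=> t0.
  have VD : is_derive t 1 (fun t : R => t^-1) (- t ^- 2).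
    apply: DeriveDef; first exact: derivableV.
    by rewrite deriveV// derive_id [LHS]mulr1.
  apply: is_derive_eq (is_deriveB (is_derive_cst _ _ _) (is_deriveZ _ VD)) _.
  rewrite sub0r -scalerN opprK.
  by have -> : h t = 4 * A * r * (t^-1 * t^-1) by []; rewrite -expr2 exprVn.
have zC i : continuous (z i).
  move=> x; apply: (@continuousB _ _ _ (fun x : 'rV[R]_n => x 0 i)).
    exact: coord_continuous.
  exact: cst_continuous.
have gC : continuous g.
  move=> t; apply: differentiable_continuous; apply/derivable1_diffP.
  by have [] := gD t.
have kC (t : R) : t != 0 -> {for t, continuous k}.
  move=> t0; apply: differentiable_continuous; apply/derivable1_diffP.
  by have [] := kD t t0.
have hC (t : R) : t != 0 -> {for t, continuous h}.
  move=> t0; apply: differentiable_continuous; apply/derivable1_diffP.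
  by apply: derivableZ; apply: derivableX; apply: derivableV.
have dE (x : 'rV[R]_n) j :
    \sum_(i < n) (x - y) 0 i * (delta_mx 0 j : 'rV[R]_n) 0 i = z j x.
  rewrite (bigD1 j)//= big1 => [|i /negPf ij]; last first.
    by rewrite [X in _ * X]mxE ij andbF mulr0.
  by rewrite [X in _ * X]mxE !eqxx mulr1 addr0 zE.
(* the gradient of [g \o q] is [k (q x) *: (x - y)], as [k t = g' t / t] *)
pose P i := z i * (k \o q).
pose H i j := z i * ((h \o q) * (z j * (fun x => (q x)^-1))) +
  cst ((i == j)%:R) * (k \o q).
have kE t : k t = 2 * A - 4 * A * r * t^-1 by [].
have hE t : h t = 4 * A * r * (t^-1 * t^-1) by [].
have PE i x : P i x = z i x * k (q x) by [].
have HE i j x : H i j x = z i x * (h (q x) * (z j x * (q x)^-1)) +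
  (i == j)%:R * k (q x) by [].
have [|C2 ->] := @C2_near_intro _ _ w P H p.
  near=> x.
  have xy : x != y.
    rewrite -subr_eq0 -eucl_norm_eq0 -/(q x) gt_eqF//; near: x.
    apply: (cvgr_gt (q p) (qC p)).
    by rewrite lt_def eucl_norm_eq0 subr_eq0 py eucl_norm_ge0.
  have qx : q x != 0 by rewrite eucl_norm_eq0 subr_eq0.
  have qD j := is_derive_eucl_normB (delta_mx 0 j) xy.
  have kqC : {for x, continuous (k \o q)}.
    by apply: continuous_comp; [exact: qC|exact: kC].
  split; first by apply: (@continuous_comp _ _ _ q g); [exact: qC|exact: gC].
  move=> i; split.
  - apply: is_derive_eq (is_derive_comp1 (qD i) (gD (q x))) _.
    by rewrite dE PE kE -/(q x); field.
  - by apply: continuousM; [exact: zC|].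
  - move=> j; split.
      have zD : is_derive x (delta_mx 0 j : 'rV[R]_n) (z i) ((i == j)%:R).
        apply: is_derive_eq; first exact: is_deriveB (is_derive_coord _ _ _) _.
        by rewrite mxE eqxx subr0.
      apply: is_derive_eq (is_deriveM zD (is_derive_comp1 (qD j) (kD _ qx))) _.
      by rewrite dE HE /GRing.scale/= -/(q x); ring.
    apply: (@continuousD _ _ _ (z i * _) (_ * _)); apply: continuousM.
    + exact: zC.
    + apply: continuousM; first by apply: continuous_comp; [exact: qC|exact: hC].
      by apply: continuousM; [exact: zC|apply: continuousV; [|exact: qC]].
    + exact: cst_continuous.
    + by [].
split=> //.
have q0 : q p != 0 by rewrite eucl_norm_eq0 subr_eq0.
have qE : q p ^+ 2 = \sum_i z i p ^+ 2.
  by rewrite eucl_norm_sqr; under eq_bigr do rewrite -zE.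
(* Since [g' t = t * k t], the factor [k + h q] is [g''], and [k^2] times the sum of the [z_i^2] is
   [g'^2]. *)
transitivity (\sum_(i < n)
    (k (q p) ^+ 2 * (k (q p) + h (q p) * q p)) * z i p ^+ 2); last first.
  by rewrite -mulr_sumr -qE kE hE -/(q p); field.
apply: eq_bigr => i _.
(* The Hessian splits into a rank-one part and a multiple of the identity; the latter survives only
   for [j = i]. *)
transitivity (\sum_(j < n)
  ((k (q p) ^+ 2 * z i p ^+ 2 * h (q p) / q p) * z j p ^+ 2 +
    (if j == i then k (q p) ^+ 3 * z i p ^+ 2 else 0))).
  apply: eq_bigr => j _; rewrite !PE HE eq_sym.
  by case: eqP => [->|_]; rewrite ?mulr1n ?mulr0n; ring.
rewrite big_split/= -mulr_sumr -qE -big_mkcond big_pred1_eq.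
by field.
Unshelve. all: by end_near. Qed.

(* Since points have positive capacity for the infinity Laplacian, the barrier
   may be singular at its pole [y]: no test function is needed there. *)
Lemma visc_le_pole_lt {R : realType} {n : nat} (D : set 'rV[R]_n)
    (f u : 'rV[R]_n -> R) (M A r : R) (y x0 : 'rV[R]_n) :
  (forall x, eucl_norm (x - y) <= r -> D x) ->
  (forall x, D x -> {for x, continuous u}) ->
  (forall x, D x -> 0 <= u x) ->
  (forall x, D x -> f x <= M) ->
  visc_le D u f ->
  0 < A -> 0 < r -> M < 8 * A ^+ 3 * r ^+ 2 ->
  eucl_norm (x0 - y) < r -> u x0 = 0 -> u y < 3 * A * r ^+ 2.
Proof.
move=> BD uC u_ge0 fM uf A_gt0 r_gt0 MA x0y ux0; rewrite ltNge; apply/negP => uy.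
pose w m x := A * ((2 * r - eucl_norm (x - y)) ^+ 2 - r ^+ 2) + m.
pose K := [set x | eucl_norm (x - y) <= r].
have Ky : K y by rewrite /K/= subrr eucl_norm0 ltW.
have wC m : continuous (w m).
  pose g := A *: ((cst (2 * r) - id) ^+ 2 - cst (r ^+ 2)) + cst m : R -> R.
  have -> : w m = g \o (fun x => eucl_norm (x - y)) by [].
  move=> x; apply: continuous_comp.
    exact: eucl_normB_continuous.
  apply: differentiable_continuous; apply/derivable1_diffP.
  exact: ex_derive.
have uwC : {within K, continuous (u \- w 0)}.
  apply: continuous_in_subspaceT => x /set_mem /BD Dx.
  by apply: continuousB; [exact: uC|exact: wC].
have [p /set_mem Kp pmin] :=
  compact_EVT_min (ex_intro _ y Ky) (@compact_eucl_closed_ball R n y r) uwC.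
have {}pmin x : K x -> u p - w 0 p <= u x - w 0 x.
  by move=> Kx; apply: pmin; exact: mem_set.
(* At [x0] the function [u] vanishes while the barrier is positive, so the minimum is negative. *)
have m_lt0 : u p - w 0 p < 0.
  apply: (le_lt_trans (pmin x0 (ltW x0y))).
  rewrite ux0 sub0r oppr_lt0 /w addr0 mulr_gt0//.
  by have := eucl_norm_ge0 (x0 - y); nra.
(* At the pole the barrier equals [3 A r^2], which is at most [u y] by the assumption [uy]. *)
have py : p != y.
  apply/eqP => pE; move: m_lt0; rewrite pE /w subrr eucl_norm0; nra.
(* On the sphere the barrier is zero and [u] is nonnegative, so the minimum is interior. *)
have pr : eucl_norm (p - y) < r.
  rewrite lt_def Kp andbT eq_sym; apply/eqP => pE; move: m_lt0; rewrite /w pE.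
  by have := u_ge0 _ (BD _ Kp); nra.
have [C2 LE] := cone_infty_laplacian A r (u p - w 0 p) py.
(* Raised by the minimum value, the barrier touches [u] from below at [p]. *)
have : infty_laplacian (w (u p - w 0 p)) p <= f p.
  apply: uf => //; first exact: BD.
  split; first by rewrite /w; ring.
  near=> x; have xr : eucl_norm (x - y) < r.
    by near: x; apply: (cvgr_lt _ (@eucl_normB_continuous R n y p)).
  by have := pmin x (ltW xr); rewrite /w; lra.
rewrite LE => lef; have fpM := fM p (BD _ Kp); suff : 8 * A ^+ 3 * r ^+ 2 <=
  8 * A ^+ 3 * (2 * r - eucl_norm (p - y)) ^+ 2 by lra.
rewrite ler_pM2l ?mulr_gt0 ?exprn_gt0//; nra.
Unshelve. all: by end_near. Qed.

(** * The unit sphere and the distance to it *)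

Lemma boundary_eucl_ball_norm_ge1 {R : realType} {n : nat} (y : 'rV[R]_n) :
  boundary (eucl_ball 0 1) y -> 1 <= eucl_norm y.
Proof.
move=> [_ yi]; rewrite leNgt; apply/negP => y1; apply: yi.
by rewrite (interior_id _).1 /eucl_ball/= ?subr0//; exact: open_eucl_ball.
Qed.

(** Along the ray [t *: y], points with [t] tending to 1 from below lie in the ball, those with [t]
    tending to 1 from above lie outside. *)
Lemma boundary_eucl_ball_norm1 {R : realType} {n : nat} (y : 'rV[R]_n) :
  eucl_norm y = 1 -> boundary (eucl_ball 0 1) y.
Proof.
move=> y1.
have yC : (fun t : R => t *: y) @ (1 : R) --> y.
  by rewrite -[X in _ --> X]scale1r; apply: cvgZr_tmp; exact: cvg_id.
split=> [A /yC yA|].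
  have /filter_ex[t [At t0 t1]] :
      \forall t \near (1 : R)^'-, [/\ A (t *: y), 0 < t & t < 1].
    near=> t; split; near: t; last exact: nbhs_left_lt.
      by apply: cvg_at_left_filter yA; exact: cvg_id.
    exact: nbhs_left_gt.
  exists (t *: y); split=> //.
  by rewrite /eucl_ball/= subr0 eucl_normZ y1 mulr1 gtr0_norm.
move=> /yC yA.
have /filter_ex[t [At t1]] :
    \forall t \near (1 : R)^'+, eucl_ball 0 1 (t *: y) /\ 1 < t.
  near=> t; split; near: t; last exact: nbhs_right_gt.
  by apply: cvg_at_right_filter yA; exact: cvg_id.
move: At; rewrite /eucl_ball/= subr0 eucl_normZ y1 mulr1.
by rewrite gtr0_norm ?(lt_trans ltr01)// ltNge (ltW t1).
Unshelve. all: by end_near. Qed.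

(** The radial projection of [x] attains the distance; at the origin any unit vector does, and
    [0 < n] provides one. *)
Lemma eucl_dist_boundary_ball {R : realType} {n : nat} (x : 'rV[R]_n) :
  (0 < n)%N -> eucl_ball 0 1 x ->
  eucl_dist x (boundary (eucl_ball 0 1)) = (1 - eucl_norm x)%:E.
Proof.
move=> n0; rewrite /eucl_ball/= subr0 => x1; apply/eqP; rewrite eq_le; apply/andP; split.
  have [p p1 xp] : exists2 p : 'rV[R]_n, eucl_norm p = 1 &
      eucl_norm (x - p) = 1 - eucl_norm x.
    have [x0|x0] := eqVneq x 0.
      exists (delta_mx 0 (Ordinal n0)); first exact: eucl_norm_delta.
      by rewrite x0 sub0r eucl_normN eucl_norm_delta eucl_norm0 subr0.
    have nx0 : eucl_norm x != 0 by rewrite eucl_norm_eq0.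
    have nx_gt0 : 0 < eucl_norm x by rewrite lt_def nx0 eucl_norm_ge0.
    exists ((eucl_norm x)^-1 *: x).
      by rewrite eucl_normZ gtr0_norm ?invr_gt0// mulVf.
    rewrite -[X in X - _]scale1r -scalerBl eucl_normZ distrC ger0_norm.
      by rewrite mulrBl mulVf// mul1r.
    by rewrite subr_ge0 invf_ge1// ltW.
  apply: ereal_inf_lbound; exists p; last by rewrite xp.
  exact: boundary_eucl_ball_norm1.
apply/ereal_infP => _ [p /boundary_eucl_ball_norm_ge1 p1 <-].
rewrite lee_fin lerBlDr (le_trans p1)//.
rewrite -{1}(subrK x p) (le_trans (ler_eucl_normD _ _))// lerD2r.
by rewrite -eucl_normN opprB.
Qed.

(** * Growth at a free boundary point *)

(** If [u x] were positive, continuity would make [x] interior to the positivity set. *)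
Lemma boundary_positivity_eq0 {R : realType} {n : nat} (D : set 'rV[R]_n)
    (u : 'rV[R]_n -> R) (x : 'rV[R]_n) :
  open D -> D x -> {for x, continuous u} -> 0 <= u x ->
  boundary (positivity_set D u) x -> u x = 0.
Proof.
move=> oD Dx uC u0 [_ nix]; apply/eqP; rewrite eq_le u0 andbT leNgt.
apply/negP => ux; apply: nix; apply: filterI; first exact: open_nbhs_nbhs.
exact: (cvgr_gt _ uC).
Qed.

Lemma visc_le_growth {R : realType} {n : nat} (D : set 'rV[R]_n)
    (f u : 'rV[R]_n -> R) (M r : R) (x0 y : 'rV[R]_n) :
  (forall x, D x -> {for x, continuous u}) ->
  (forall x, D x -> 0 <= u x) ->
  (forall x, D x -> f x <= M) ->
  visc_le D u f ->
  0 < r -> eucl_ball x0 (2 * r) `<=` D -> u x0 = 0 ->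
  eucl_ball x0 r y -> u y <= 3 * (`|M| + 1) * r `^ (4 / 3).
Proof.
move=> uC u_ge0 fM uf r_gt0 BD ux0; rewrite /eucl_ball/= => yr.
set c := `|M| + 1; set s := r `^ (4 / 3).
have c_ge1 : 1 <= c by rewrite /c lerDr.
have s_gt0 : 0 < s by exact: powR_gt0.
have s3 : s ^+ 3 = r ^+ 4.
  rewrite /s -powR_mulrn ?powR_ge0// -powRrM -powR_mulrn ?ltW//.
  by congr (_ `^ _); field.
(* With this amplitude [A r^2 = c r^(4/3)] and [A^3 r^2 = c^3], which is where the exponent 4/3
   comes from. *)
pose A := c * s / r ^+ 2.
(* The midpoint is larger than the distance from [y] to [x0], so the ball about [y] contains [x0],
   and smaller than [r], so its closure stays in the ball of radius [2 r] about [x0]. *)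
pose rho := (r + eucl_norm (y - x0)) / 2.
have q0 := eucl_norm_ge0 (y - x0).
have A_gt0 : 0 < A by rewrite divr_gt0 ?exprn_gt0// mulr_gt0// (lt_le_trans _ c_ge1).
have rho_lt : rho < r by rewrite /rho; lra.
have rho_gt : r / 2 <= rho by rewrite /rho; lra.
have rho_gt0 : 0 < rho by lra.
have Arho : A * rho ^+ 2 <= c * s.
  rewrite -[leRHS](@divfK _ (r ^+ 2)) ?expf_neq0 ?gt_eqF// -/A.
  by rewrite ler_pM2l// lerXn2r ?nnegrE ?ltW.
(* As [rho >= r / 2], the right side is at least [2 c^3], and [c^3 >= c > M]. *)
have MA : M < 8 * A ^+ 3 * rho ^+ 2.
  have A3 : A ^+ 3 * r ^+ 2 = c ^+ 3.
    by rewrite /A !exprMn s3 -exprVn; field; rewrite gt_eqF.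
  have Mc : M < c by rewrite /c (le_lt_trans (ler_norm M))// ltrDl.
  have c3 : c <= c ^+ 3 by rewrite ler_eXnr.
  have : A ^+ 3 * (r / 2) ^+ 2 <= A ^+ 3 * rho ^+ 2.
    by rewrite ler_pM2l ?exprn_gt0// lerXn2r// nnegrE ltW// divr_gt0.
  have -> : A ^+ 3 * (r / 2) ^+ 2 = c ^+ 3 / 4 by rewrite -A3; field.
  by lra.
suff : u y < 3 * A * rho ^+ 2.
  by move/ltW/le_trans; apply; rewrite -(mulrA 3 A) -(mulrA 3 c) ler_pM2l.
apply: (@visc_le_pole_lt _ _ D f u M A rho y x0) => // [x xy|].
  apply: BD; rewrite /eucl_ball/= -(subrK y x) -addrA.
  by rewrite (le_lt_trans (ler_eucl_normD _ _))//; lra.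
by rewrite -eucl_normN opprB /rho; lra.
Qed.

Theorem theorem3p3 (R : realType) (n : nat) (nu M s d : R) :
  (0 < n)%N -> 0 < nu ->
  exists2 C : R, 0 < C &
    forall (f u : 'rV[R]_n -> R) (x0 : 'rV[R]_n),
      {within eucl_ball 0 1, continuous f} ->
      (forall x, eucl_ball 0 1 x -> nu <= f x <= M) ->
      {within closure (eucl_ball 0 1), continuous u} ->
      visc_obstacle (eucl_ball 0 1) f u ->
      boundary (positivity_set (eucl_ball 0 1) u) x0 ->
      eucl_ball 0 1 x0 ->
      esup_on (eucl_ball 0 1) u = s%:E ->
      eucl_dist x0 (boundary (eucl_ball 0 1)) = d%:E ->
      forall r : R, 0 < r ->
        eucl_ball x0 r `<=` eucl_ball 0 1 ->
        (esup_on (eucl_ball x0 r) u <= (C * r `^ (4 / 3))%:E)%E.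
Proof.
move=> n_gt0 _.
(* [c] serves the radii with [2 r <= d], [K] the others. The absolute value makes [K] nonnegative
   before anything is known about [s] and [d]. *)
pose c := 3 * (`|M| + 1); pose K := `|s| * (2 / d) `^ (4 / 3).
have c_gt0 : 0 < c by rewrite mulr_gt0// ltr_wpDl.
have K_ge0 : 0 <= K by rewrite mulr_ge0// powR_ge0.
exists (c + K); first by rewrite ltr_wpDr.
move=> f u x0 _ f_bnd uC [u_ge0 uf _] x0_bd x0B us x0d r r_gt0 rB.
have oB : open (eucl_ball (0 : 'rV[R]_n) 1) by exact: open_eucl_ball.
have {}uC x : eucl_ball 0 1 x -> {for x, continuous u}.
  move: (continuous_subspaceW (@subset_closure _ _) uC).
  rewrite (continuous_open_subspace _ oB) => + xB; apply.
  exact: mem_set.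
have ux0 : u x0 = 0.
  exact: boundary_positivity_eq0 oB x0B (uC _ x0B) (u_ge0 _ x0B) x0_bd.
have dE : d = 1 - eucl_norm x0.
  by apply/EFin_inj; rewrite -x0d eucl_dist_boundary_ball.
have d_gt0 : 0 < d.
  by move: x0B; rewrite /eucl_ball/= subr0 dE subr_gt0.
have p_ge0 : 0 <= r `^ (4 / 3) by exact: powR_ge0.
apply/ereal_supP => _ [y yr <-]; rewrite lee_fin mulrDl.
have [rd|dr] := leP (2 * r) d.
  apply: ler_wpDr; first exact: mulr_ge0.
  apply: visc_le_growth uC u_ge0 _ uf r_gt0 _ ux0 yr => [x /f_bnd/andP[]//|x].
  rewrite /eucl_ball/= subr0 => xx0; rewrite -(subrK x0 x).
  by rewrite (le_lt_trans (ler_eucl_normD _ _))//; lra.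
apply: ler_wpDl; first by rewrite mulr_ge0// ltW.
have us_y : u y <= s.
  by rewrite -lee_fin -us; apply: ereal_sup_ubound; exists y => //; exact: rB.
rewrite (le_trans us_y)// (le_trans (ler_norm s))// /K -mulrA.
have d2_gt0 : 0 < 2 / d by exact: divr_gt0.
(* Hence [(2 r / d)^(4/3) >= 1], and the constant bound [s] is absorbed into [K r^(4/3)]. *)
have dr1 : 1 <= 2 / d * r by rewrite mulrAC ler_pdivlMr// mul1r ltW.
rewrite -powRM ?(ltW d2_gt0) ?(ltW r_gt0)// ler_peMr//.
apply: (@le_trans _ _ (1 `^ (4 / 3))); first by rewrite powR1.
by rewrite ge0_ler_powR ?nnegrE ?(le_trans ler01 dr1)// divr_ge0.
Qed.
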